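(* Let $G\subset \mathrm{GL}(n)$ be a matrix Lie group with Lie algebra $\mathfrak g\subset\mathbb R^{n\times n}$, and let $(g(t),\xi(t))\in G\times\mathfrak g$, $0\le t<\infty$, be an arbitrary trajectory of $\dot g=g\xi$. Assume: (1) $A(t)=g(t)^{-1}F$ for all $t\ge 0$, where $F\in\mathbb R^{n\times n}$ is a constant invertible matrix; (2) $\xi_{\rm m}(t)=\xi(t)+b$ for all $t\ge0$, where $b\in\mathfrak g$ is constant; (3) there are constants $B_\xi>0$, $B_b>0$ with $\|\xi(t)\|\le B_\xi$ for all $t\ge 0$ and $\|b\|\le B_b$, and there are numbers $L_g>0$, $U_g>0$ with $L_g\le\sigma_{\min}(g(t))\le\sigma_{\max}(g(t))\le U_g$ for all $t\ge0$. Consider the observer with state $(\bar A,\bar b)\in\mathbb R^{n\times n}\times\mathfrak g$ given by $$\dot{\bar A}=-\xi_{\rm m}\bar A+\bar b A+k_P(A-\bar A),\qquad \dot{\bar b}=k_I\,\pi_{\mathfrak g}\big((A-\bar A)A^T\big),$$ and let $E_A=A-\bar A$, $e_b=b-\bar b$. Then for any $k_P>B_\xi+B_b$ and $k_I>0$ there exist numbers $a>0$ and $C>0$ such that $$\|E_A(t)\|+\|e_b(t)\|\le C\big(\|E_A(0)\|+\|e_b(0)\|\big)e^{-at}$$ for all $t\ge0$ and all initial conditions $(\bar A(0),\bar b(0))\in\mathbb R^{n\times n}\times\mathfrak g$ (with $a$, $C$ not depending on the initial condition).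
   Context: $\mathrm{GL}(n)=\{A\in\mathbb R^{n\times n}\mid\det A\ne0\}$; the Lie algebra $\mathfrak g$ of $G$ is regarded as a Lie subalgebra of $\mathbb R^{n\times n}$ with the matrix commutator. $\langle A,B\rangle=\operatorname{tr}(A^TB)$ is the Euclidean inner product on $\mathbb R^{n\times n}$, and $\|A\|=\sqrt{\langle A,A\rangle}$ is the Frobenius norm. $\pi_{\mathfrak g}:\mathbb R^{n\times n}\to\mathfrak g$ is the orthogonal projection onto $\mathfrak g$ with respect to $\langle\cdot,\cdot\rangle$. $\sigma_{\min}(\cdot)$ and $\sigma_{\max}(\cdot)$ denote the minimum and maximum singular values. *)

(* Defs.v *)
From HB Require Import structures.
From mathcomp Require Import all_boot all_order all_algebra.
From mathcomp Require Import all_classical all_reals all_analysis.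

Set Implicit Arguments.
Unset Strict Implicit.
Unset Printing Implicit Defensive.

Import Order.TTheory GRing.Theory Num.Theory.
Import numFieldNormedType.Exports.

Local Open Scope classical_set_scope.
Local Open Scope ring_scope.

Section FrobeniusGeometry.
Context {R : realType} {n : nat}.
Local Notation M := 'M[R]_n.+1.

Definition frob_inner (A B : M) : R := \tr (A^T *m B).

(* The norm [`|A|] that the library puts on matrices is the max norm of the
   entries; it is only used for the topology of the matrix space. *)
Definition frob_norm (A : M) : R := Num.sqrt (frob_inner A A).

(* The orthogonal projection of [X] onto the linear subspace [V] is the element
   [Y] of [V] such that [X - Y] is orthogonal to [V]; it exists and is unique
   when [V] is a linear subspace. *)
Definition orth_proj (V : set M) (X : M) : M :=
  xget 0 [set Y | V Y /\ forall Z, V Z -> frob_inner (X - Y) Z = 0].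

(* [eigenvalue] refers to row eigenvectors, which makes no difference for the
   symmetric matrix A^T A. *)
Definition singular_values (A : M) : set R :=
  [set Num.sqrt l | l in [set l : R | eigenvalue (A^T *m A) l]].

(* The set of singular values of a matrix of positive size is finite and
   nonempty, so the infimum and the supremum are a minimum and a maximum. *)
Definition sigma_min (A : M) : R := inf (singular_values A).
Definition sigma_max (A : M) : R := sup (singular_values A).

End FrobeniusGeometry.

Section MatrixLieGroups.
Context {R : realType} {n : nat}.
Local Notation M := 'M[R]_n.+1.

Definition GL : set M := [set A | \det A != 0].

(* A matrix Lie group is a subgroup of GL(n) that is closed in GL(n), though
   not necessarily in the space of all matrices. *)
Definition matrix_Lie_group (G : set M) : Prop :=
  [/\ G `<=` GL,
      G 1%:M,
      (forall A B, G A -> G B -> G (A *m B)),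
      (forall A, G A -> G (invmx A)) &
      closure G `&` GL `<=` G].

(* The tangent space of [G] at the identity: the velocities at time 0 of the
   differentiable curves in [G] that pass through the identity at time 0. *)
Definition Lie_algebra (G : set M) : set M :=
  [set X | exists c : R -> M,
    [/\ c 0 = 1%:M,
        (\forall t \near (0 : R), G (c t) /\ derivable c t 1) &
        is_derive (0 : R) 1 c X]].

(* [f' = df] on the interval [0, +oo[: the derivative is relative to the
   interval, hence one-sided at 0. *)
Definition has_derivative_on_0y (f df : R -> M) : Prop :=
  forall t : R, 0 <= t ->
    (s - t)^-1 *: (f s - f t) @[s --> within `[0, +oo[ t^'] --> df t.

(* A solution on [0, +oo[, with state space 'M_n.+1 x V, of the observer driven
   by the signals A and xim, where V is the Lie algebra. *)
Definition observer_solution (V : set M) (kP kI : R) (A xim : R -> M)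
    (Abar bbar : R -> M) : Prop :=
  [/\ (forall t : R, 0 <= t -> V (bbar t)),
      has_derivative_on_0y Abar
        (fun t => - (xim t *m Abar t) + bbar t *m A t
                  + kP *: (A t - Abar t)) &
      has_derivative_on_0y bbar
        (fun t => kI *: orth_proj V ((A t - Abar t) *m (A t)^T))].

End MatrixLieGroups.

(* Main.v *)
Require Import Defs.
From HB Require Import structures.
From mathcomp Require Import all_boot all_order all_algebra.
From mathcomp Require Import all_classical all_reals all_analysis.
From mathcomp Require Import ring lra.
Import Order.TTheory GRing.Theory Num.Theory.
Import numFieldNormedType.Exports.
Local Open Scope classical_set_scope.
Local Open Scope ring_scope.

(** Write [E = A - Abar], [e = b - bbar], and [P] for the orthogonal projection
    of [E *m A^T] onto the Lie algebra. From [A = g^-1 F] one gets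
    [A' = - xi A], and the errors obey
<<
      E' = e A - (xi + b) E - kP E,        e' = - kI P.
>>
    Since [e] lies in the Lie algebra, [<e, P> = <e, E A^T> = <E, e A>], so in
    the derivative of [kI |E|^2 + |e|^2] the coupling terms cancel and only
    [- 2 kI <E, ((xi + b) + kP) E>] is left, which is at most
    [- 2 kI (kP - Bxi - Bb) |E|^2]. This controls [E] but not [e]. The missing
    decay of [e] comes from the cross term in
<<
      W = kI |E|^2 + |e|^2 - 2 eps <E, e A>,
>>
    whose derivative contains [- 2 eps |e A|^2]; because [A^-1] is bounded, this
    dominates a multiple of [- |e|^2]. For small [eps] the remaining terms are
    absorbed ([lyapunov_rate_le], [lyapunov_constants]), [W] stays comparable
    with [kI |E|^2 + |e|^2] ([lyapunov_sandwich]), and [W' <= - 2 a W], so that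
    [W] decays exponentially ([deriv0y_exp_decay]). All constants depend only on
    the bounds of the signals, hence not on the initial condition.

    Three facts feed this computation. The orthogonal projection has to exist,
    which requires the set of velocities of curves in [G] to be a linear
    subspace ([Lie_algebra_linear], [orth_projP]). The bounds on the singular
    values of [g] have to become bounds on the Frobenius norms of [g] and
    [g^-1]; this rests on the fact that the minimum of a symmetric quadratic
    form on the unit sphere is an eigenvalue ([rayleigh_min],
    [frob_norm_unit_bounds]). Finally [g^-1] has to be differentiated relative
    to the half-line ([deriv0y_invmx]). *)

(** * Frobenius geometry and orthogonal projection *)

(** With [a], [c] the sums of squares and [d] the sum of products, the sum of the
    squares of [c x_i - d y_i] equals [c (a c - d^2)]. *)
Lemma sum_cauchy_schwarz (R : realFieldType) (I : finType) (x y : I -> R) :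
  (\sum_i x i * y i) ^+ 2 <= (\sum_i x i ^+ 2) * (\sum_i y i ^+ 2).
Proof.
set a := \sum_i x i ^+ 2; set c := \sum_i y i ^+ 2; set d := \sum_i x i * y i.
have c0 : 0 <= c by apply: sumr_ge0 => i _; exact: sqr_ge0.
have : 0 <= \sum_i (c * x i - d * y i) ^+ 2.
  by apply: sumr_ge0 => i _; exact: sqr_ge0.
have -> : \sum_i (c * x i - d * y i) ^+ 2 = c * (a * c - d ^+ 2).
  transitivity (c ^+ 2 * a - 2 * c * d * d + d ^+ 2 * c); last by ring.
  have -> : c ^+ 2 * a = \sum_i c ^+ 2 * x i ^+ 2 by exact: mulr_sumr.
  have -> : 2 * c * d * d = \sum_i 2 * c * d * (x i * y i) by exact: mulr_sumr.
  have -> : d ^+ 2 * c = \sum_i d ^+ 2 * y i ^+ 2 by exact: mulr_sumr.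
  by rewrite -sumrB -big_split/=; apply: eq_bigr => i _; ring.
move: c0; rewrite le_eqVlt => /orP[/eqP c0 _|c0]; last first.
  by rewrite pmulr_rge0// subr_ge0.
have y0 i : y i = 0.
  apply/eqP; rewrite -sqrf_eq0; move/esym/eqP: c0.
  rewrite psumr_eq0 => [/allP/(_ i)|? _]; rewrite ?sqr_ge0 ?mem_index_enum//.
  by apply.
by rewrite -c0 mulr0 /d big1 ?expr0n// => i _; rewrite y0 mulr0.
Qed.

Section Frobenius.
Context {R : realType} {n : nat}.
Local Notation M := 'M[R]_n.+1.
Implicit Types A B C X Y Z : M.

Lemma frob_innerE A B : frob_inner A B = \sum_i \sum_j A i j * B i j.
Proof.
rewrite /frob_inner /mxtrace exchange_big/=; apply: eq_bigr => j _.
by rewrite mxE; apply: eq_bigr => i _; rewrite mxE.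
Qed.

Lemma frob_innerC A B : frob_inner A B = frob_inner B A.
Proof. by rewrite /frob_inner -mxtrace_tr trmx_mul trmxK. Qed.

Lemma frob_innerDr A B C : frob_inner A (B + C) = frob_inner A B + frob_inner A C.
Proof. by rewrite /frob_inner mulmxDr mxtraceD. Qed.

Lemma frob_innerNr A B : frob_inner A (- B) = - frob_inner A B.
Proof. by rewrite /frob_inner mulmxN raddfN. Qed.

Lemma frob_innerZr k A B : frob_inner A (k *: B) = k * frob_inner A B.
Proof. by rewrite /frob_inner -scalemxAr mxtraceZ. Qed.

Lemma frob_innerDl A B C : frob_inner (A + B) C = frob_inner A C + frob_inner B C.
Proof. by rewrite frob_innerC frob_innerDr !(frob_innerC C). Qed.

Lemma frob_innerNl A B : frob_inner (- A) B = - frob_inner A B.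
Proof. by rewrite frob_innerC frob_innerNr frob_innerC. Qed.

Lemma frob_innerZl k A B : frob_inner (k *: A) B = k * frob_inner A B.
Proof. by rewrite frob_innerC frob_innerZr frob_innerC. Qed.

Lemma frob_inner_mulr A B C :
  frob_inner A (B *m C) = frob_inner (A *m C^T) B.
Proof. by rewrite /frob_inner trmx_mul trmxK mulmxA mxtrace_mulC mulmxA. Qed.

Lemma frob_inner_sqr A : frob_inner A A = \sum_i \sum_j A i j ^+ 2.
Proof. by rewrite frob_innerE. Qed.

Lemma frob_inner_ge0 A : 0 <= frob_inner A A.
Proof.
by rewrite frob_inner_sqr; apply: sumr_ge0 => i _; apply: sumr_ge0 => j _;
  exact: sqr_ge0.
Qed.

Lemma frob_inner_eq0 A : frob_inner A A = 0 -> A = 0.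
Proof.
rewrite frob_inner_sqr pair_bigA/= => /eqP.
rewrite psumr_eq0 => [/allP h|? _]; last exact: sqr_ge0.
apply/matrixP => i j; rewrite mxE; apply/eqP.
by rewrite -sqrf_eq0; apply: (h (i, j)); rewrite mem_index_enum.
Qed.

Lemma frob_norm_ge0 A : 0 <= frob_norm A. Proof. exact: sqrtr_ge0. Qed.

Lemma sqr_frob_norm A : frob_norm A ^+ 2 = frob_inner A A.
Proof. exact/sqr_sqrtr/frob_inner_ge0. Qed.

Lemma frob_norm_tr A : frob_norm A^T = frob_norm A.
Proof. by rewrite /frob_norm /frob_inner trmxK mxtrace_mulC. Qed.

Lemma frob_normN A : frob_norm (- A) = frob_norm A.
Proof. by rewrite /frob_norm frob_innerNl frob_innerNr opprK. Qed.

Lemma frob_cauchy_schwarz A B : `|frob_inner A B| <= frob_norm A * frob_norm B.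
Proof.
rewrite -ler_sqr ?nnegrE ?mulr_ge0 ?frob_norm_ge0//.
rewrite real_normK ?num_real// exprMn !sqr_frob_norm frob_innerE !frob_inner_sqr.
by rewrite !pair_bigA/=; exact: sum_cauchy_schwarz.
Qed.

Lemma frob_normD A B : frob_norm (A + B) <= frob_norm A + frob_norm B.
Proof.
rewrite -ler_sqr ?nnegrE ?addr_ge0 ?frob_norm_ge0// sqrrD !sqr_frob_norm.
rewrite frob_innerDl !frob_innerDr (frob_innerC B A).
have := le_trans (ler_norm _) (frob_cauchy_schwarz A B); lra.
Qed.

Lemma frob_normM A B : frob_norm (A *m B) <= frob_norm A * frob_norm B.
Proof.
rewrite -ler_sqr ?nnegrE ?mulr_ge0 ?frob_norm_ge0//.
rewrite exprMn !sqr_frob_norm !frob_inner_sqr.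
rewrite [X in _ * X]exchange_big/=.
rewrite mulr_suml; apply: ler_sum => i _.
rewrite mulr_sumr; apply: ler_sum => j _.
by rewrite mxE; exact: sum_cauchy_schwarz.
Qed.

Lemma ler_entry_frob_norm A i j : `|A i j| <= frob_norm A.
Proof.
rewrite -ler_sqr ?nnegrE ?frob_norm_ge0// real_normK ?num_real//.
rewrite sqr_frob_norm frob_inner_sqr pair_bigA/= (bigD1 (i, j))//= lerDl.
by apply: sumr_ge0 => p _; exact: sqr_ge0.
Qed.

Definition linear_set (V : set M) :=
  [/\ V 0, forall X Y, V X -> V Y -> V (X + Y) & forall k X, V X -> V (k *: X)].

(** Gram-Schmidt by induction on the set [s] of coordinates that are allowed to be
    nonzero; the list of all coordinates gives the projection. Allowing one more
    coordinate enlarges the subspace by at most one direction: if some [w] in the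
    larger subspace is nonzero at the new coordinate, its component [v]
    orthogonal to the smaller subspace spans the complement. *)
Lemma orth_decomp_coords (V : set M) (s : seq ('I_n.+1 * 'I_n.+1)) :
  linear_set V ->
  forall X, exists Y,
    (V Y /\ forall i j, (i, j) \notin s -> Y i j = 0) /\
    forall Z, V Z -> (forall i j, (i, j) \notin s -> Z i j = 0) ->
      frob_inner (X - Y) Z = 0.
Proof.
move=> [V0 VD VZ]; elim: s => [|[i0 j0] s IH] X.
  exists 0; split; first by split => // i j _; rewrite mxE.
  move=> Z _ Z0; suff -> : Z = 0 by rewrite /frob_inner mulmx0 mxtrace0.
  by apply/matrixP => i j; rewrite mxE Z0.
pose W (t : seq ('I_n.+1 * 'I_n.+1)) (Z : M) :=
  V Z /\ forall i j, (i, j) \notin t -> Z i j = 0.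
have Ws Z : W s Z -> W ((i0, j0) :: s) Z.
  by move=> [VZ' Z0]; split => // i j; rewrite inE negb_or => /andP[_ /Z0].
have [ijs|ijs] := boolP ((i0, j0) \in s).
  have sE i j : ((i, j) \notin (i0, j0) :: s) = ((i, j) \notin s).
    by rewrite inE; case: eqVneq => [->|//]; rewrite ijs.
  have [Y [[VY Y0] XY]] := IH X; exists Y; split.
    by split=> // i j; rewrite sE; exact: Y0.
  by move=> Z VZ' Z0; apply: XY => // i j; rewrite -sE; exact: Z0.
have WsP Z : W ((i0, j0) :: s) Z -> Z i0 j0 = 0 -> W s Z.
  move=> [VZ' Z0] Zij; split => // i j ij_s.
  have [[-> ->//]|ne] := eqVneq (i, j) (i0, j0).
  by apply: Z0; rewrite inE negb_or ne.
have WL t k Y Z : W t Y -> W t Z -> W t (Y + k *: Z).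
  move=> [VY Y0] [VZ' Z0]; split; first exact/VD/VZ.
  by move=> i j ij; rewrite !mxE Y0// Z0// mulr0 addr0.
have [Y [WY XY]] := IH X.
have [[w [Ww wn0]]|none] :=
    pselect (exists w, W ((i0, j0) :: s) w /\ w i0 j0 != 0); last first.
  exists Y; split; first exact: Ws.
  move=> Z VZ' Z0; have [//|VZ'' Z0'] := WsP Z (conj VZ' Z0).
    by apply/eqP; apply: contrapT => /negP Zn0; apply: none; exists Z.
  exact: XY.
have [p [Wp wp]] := IH w.
pose v := w - p.
have Wv : W ((i0, j0) :: s) v.
  by rewrite /v -scaleN1r; apply: WL => //; exact: Ws.
have vorth Z : W s Z -> frob_inner v Z = 0 by case=> *; exact: wp.
(* [p] vanishes at the new coordinate, so [v] inherits the nonzero entry of [w]. *)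
have vij : v i0 j0 != 0 by rewrite !mxE (Wp.2 _ _ ijs) subr0.
clearbody v.
have vn0 : frob_inner v v != 0.
  by apply: contra vij => /eqP /frob_inner_eq0 ->; rewrite mxE.
exists (Y + (frob_inner X v / frob_inner v v) *: v); split.
  by apply: WL => //; exact: Ws.
move=> Z VZ' Z0; pose k := Z i0 j0 / v i0 j0.
have [Z' WZ' ->] : exists2 Z', W s Z' & Z = Z' + k *: v.
  exists (Z - k *: v); last by rewrite addrNK.
  rewrite -scaleNr; apply: WsP; first exact: WL.
  by rewrite mxE [X in _ + X]mxE mulNr /k divfK// subrr.
rewrite opprD addrA frob_innerDl frob_innerNl frob_innerZl !frob_innerDr.
rewrite !frob_innerZr (XY _ WZ'.1 WZ'.2) (vorth _ WZ').
rewrite frob_innerDl frob_innerNl (frob_innerC Y) (vorth _ WY).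
by field.
Qed.

Lemma orth_projP (V : set M) X : linear_set V ->
  V (orth_proj V X) /\
  forall Z, V Z -> frob_inner (orth_proj V X) Z = frob_inner X Z.
Proof.
move=> linV; have [Y [[VY _] XY]] := orth_decomp_coords V (index_enum _) linV X.
have [|VP PX] := @xgetPex _ 0
  [set Y | V Y /\ forall Z, V Z -> frob_inner (X - Y) Z = 0].
  by exists Y; split => // Z VZ; apply: XY => // i j; rewrite mem_index_enum.
split=> // Z /PX /eqP; rewrite frob_innerDl frob_innerNl subr_eq0 => /eqP ->.
by [].
Qed.

End Frobenius.

(** * Minimum of a quadratic form on the sphere *)

Lemma cvg_sum (R : realType) (T : Type) (F : set_system T) (I : finType)
    (f : I -> T -> R) (l : I -> R) {FF : Filter F} :
  (forall i, f i x @[x --> F] --> l i) ->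
  \sum_i f i x @[x --> F] --> \sum_i l i.
Proof.
move=> fl; apply: cvg_big => [x|i _]; [exact: add_continuous|exact: fl].
Qed.

(** Otherwise [t = - p / (q + 1)] makes the polynomial negative. *)
Lemma linear_term_eq0 (R : realFieldType) (p q : R) : 0 <= q ->
  (forall t, 0 <= 2 * t * p + t ^+ 2 * q) -> p = 0.
Proof.
move=> q0 /(_ (- (p / (q + 1)))).
have -> : 2 * - (p / (q + 1)) * p + (- (p / (q + 1))) ^+ 2 * q =
    - (p ^+ 2 * ((q + 2) / (q + 1) ^+ 2)) by field; lra.
rewrite oppr_ge0 pmulr_lle0; last by apply: divr_gt0; [|apply: exprn_gt0]; lra.
move=> p2; apply/eqP; rewrite -sqrf_eq0; apply/eqP/le_anti.
by rewrite p2 sqr_ge0.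
Qed.

Section Rayleigh.
Context {R : realType} {n : nat}.
Local Notation M := 'M[R]_n.+1.
Implicit Types (x y : 'rV[R]_n.+1) (Q S : M).

(** The matrix of the form acts on the right of row vectors, to match
    [eigenvalue], which refers to row eigenvectors. *)
Definition bform Q x y : R := (x *m Q *m y^T) 0 0.

Lemma bformDl Q x y z : bform Q (x + y) z = bform Q x z + bform Q y z.
Proof. by rewrite /bform !mulmxDl mxE. Qed.

Lemma bformDr Q x y z : bform Q x (y + z) = bform Q x y + bform Q x z.
Proof. by rewrite /bform linearD/= mulmxDr mxE. Qed.

Lemma bformZl Q k x z : bform Q (k *: x) z = k * bform Q x z.
Proof. by rewrite /bform -!scalemxAl mxE. Qed.

Lemma bformZr Q k x z : bform Q x (k *: z) = k * bform Q x z.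
Proof. by rewrite /bform linearZ/= -scalemxAr mxE. Qed.

Lemma bformC Q x y : Q^T = Q -> bform Q x y = bform Q y x.
Proof.
move=> sQ; rewrite /bform.
have -> : (x *m Q *m y^T) 0 0 = (x *m Q *m y^T)^T 0 0 by rewrite [RHS]mxE.
by rewrite !trmx_mul trmxK sQ mulmxA.
Qed.

Lemma bform_sub Q l x y : bform (Q - l%:M) x y = bform Q x y - l * bform 1%:M x y.
Proof. by rewrite /bform mulmxBr mulmxBl mul_mx_scalar mulmx1 -scalemxAl !mxE. Qed.

Lemma bform1 x : bform 1%:M x x = \sum_j x 0 j ^+ 2.
Proof. by rewrite /bform mulmx1 mxE; apply: eq_bigr => j _; rewrite mxE. Qed.

Lemma bform1_gt0 x : x != 0 -> 0 < bform 1%:M x x.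
Proof.
move=> x0; rewrite bform1 lt_def sumr_ge0 ?andbT => [|? _]; last exact: sqr_ge0.
apply: contra x0; rewrite psumr_eq0 => [/allP h|? _]; last exact: sqr_ge0.
apply/eqP/rowP => j; rewrite mxE; apply/eqP.
by rewrite -sqrf_eq0; apply: h; rewrite mem_index_enum.
Qed.

Lemma bform_continuous Q : continuous (fun x => bform Q x x).
Proof.
have -> : (fun x => bform Q x x) =
    fun x => \sum_j (\sum_k x 0 k * Q k j) * x 0 j.
  by apply/funext => x; rewrite /bform mxE; apply: eq_bigr => j _; rewrite !mxE.
move=> x; apply: (@cvg_sum _ _ (nbhs x)) => j.
apply: cvgM; last exact: coord_continuous.
apply: (@cvg_sum _ _ (nbhs x)) => k; apply: cvgM; first exact: coord_continuous.
exact: cvg_cst.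
Qed.

(** For every [y] the polynomial [t |-> Q(x + t y)] is nonnegative and vanishes at
    [0], so its linear coefficient is zero; the choice [y = x Q] is enough. *)
Lemma psd_isotropic Q x : Q^T = Q -> (forall y, 0 <= bform Q y y) ->
  bform Q x x = 0 -> x *m Q = 0.
Proof.
move=> sQ Q0 x0; set y := x *m Q.
have xy : bform Q x y = bform 1%:M y y by rewrite /bform mulmx1.
apply/eqP; apply: contrapT => /negP /bform1_gt0; rewrite -xy.
suff -> : bform Q x y = 0 by rewrite ltxx.
apply: linear_term_eq0 (Q0 y) _ => t; have := Q0 (x + t *: y).
rewrite bformDl !bformDr !bformZl !bformZr x0 (bformC Q y)// add0r.
set p := bform Q x y; set q := bform Q y y.
by have -> : 2 * t * p + t ^+ 2 * q = t * p + (t * p + t * (t * q)) by ring.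
Qed.

(** A minimiser [x0] of the form on the compact unit sphere, with value [l], is an
    isotropic vector of the positive semidefinite matrix [Q - l], hence lies in
    its kernel. *)
Lemma rayleigh_min Q : Q^T = Q ->
  exists2 l, eigenvalue Q l & forall x, l * bform 1%:M x x <= bform Q x x.
Proof.
move=> sQ; pose S := [set x : 'rV[R]_n.+1 | bform 1%:M x x = 1].
have normS x : x != 0 -> exists2 k, k != 0 & S (k *: x).
  move=> /bform1_gt0 x0; exists (Num.sqrt (bform 1%:M x x))^-1.
    by rewrite invr_eq0 gt_eqF// sqrtr_gt0.
  rewrite /S/= bformZl bformZr mulrA -expr2 exprVn sqr_sqrtr ?ltW//.
  by rewrite mulVf// gt_eqF.
have S0 : S !=set0.
  have [|k _ Sk] := normS (delta_mx 0 0); last by exists (k *: delta_mx 0 0).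
  by apply/eqP => /matrixP/(_ 0 0)/eqP; rewrite !mxE !eqxx oner_eq0.
have Sc : compact S.
  apply: bounded_closed_compact.
    exists 1; split; first exact: num_real.
    move=> r r1 x Sx /=; rewrite /Num.Def.normr/= mx_normrE.
    apply: bigmax_le => [|[i j] _ /=]; first lra.
    apply: le_trans (ltW r1).
    rewrite -ler_sqr ?nnegrE// real_normK ?num_real// expr1n.
    rewrite (ord1 i) -[leRHS]Sx bform1 (bigD1 j)//= lerDl.
    by apply: sumr_ge0 => k _; exact: sqr_ge0.
  by apply: (closed_comp _ (@closed_eq _ _)) => x _; exact: bform_continuous.
have [|x0 Sx0 minx0] := @EVT_min_rV _ _ (fun x => bform Q x x) _ S0 Sc.
  by apply: continuous_subspaceT; exact: bform_continuous Q.
rewrite inE in Sx0; set l := bform Q x0 x0 in minx0.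
have lmin x : l * bform 1%:M x x <= bform Q x x.
  have [->|/normS[k k0 Sk]] := eqVneq x 0.
    by rewrite -[0](scale0r (0 : 'rV[R]_n.+1)) !bformZl !mul0r mulr0.
  have := minx0 (k *: x); rewrite inE => /(_ Sk).
  have := Sk; rewrite /S/= !bformZl !bformZr !mulrA -expr2 => k1.
  have k2 : 0 < k ^+ 2 by rewrite exprn_even_gt0.
  by move=> lk; rewrite -(ler_pM2l k2) mulrCA k1 mulr1.
exists l => //; apply/eigenvalueP; exists x0; last first.
  apply/eqP => x00; move: Sx0; rewrite /S/= x00.
  rewrite -[0](scale0r (0 : 'rV[R]_n.+1)) bformZl mul0r => /eqP.
  by rewrite eq_sym oner_eq0.
apply/eqP; rewrite -subr_eq0 -mul_mx_scalar -mulmxBr; apply/eqP.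
apply: psd_isotropic => [|y|].
- by rewrite linearB/= sQ tr_scalar_mx.
- by rewrite bform_sub subr_ge0.
- by rewrite bform_sub Sx0 mulr1 subrr.
Qed.

End Rayleigh.

(** * Singular values and the Frobenius norm *)

Section SingularValues.
Context {R : realType} {n : nat}.
Local Notation M := 'M[R]_n.+1.
Implicit Types (x : 'rV[R]_n.+1) (g X Q : M).

(** [Q] is a parameter, tied to [g] by an equation, so that the case [g = 1] can be
    read with [Q = 1]. *)
Lemma frob_norm_rows Q g X : Q = g^T *m g ->
  frob_norm (g *m X) ^+ 2 = \sum_i bform Q (row i X^T) (row i X^T).
Proof.
move=> ->; rewrite sqr_frob_norm /frob_inner trmx_mul mulmxA -(mulmxA X^T).
apply: eq_bigr => i _; rewrite /bform -row_mul !mxE.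
by apply: eq_bigr => j _; rewrite !mxE.
Qed.

Lemma frob_norm_rows1 X :
  frob_norm X ^+ 2 = \sum_i bform 1%:M (row i X^T) (row i X^T).
Proof.
rewrite -[X in frob_norm X]mul1mx; apply: frob_norm_rows.
by rewrite trmx1 mulmx1.
Qed.

Lemma gram_sym g : (g^T *m g)^T = g^T *m g.
Proof. by rewrite trmx_mul trmxK. Qed.

Lemma gram_eigenvector g l : eigenvalue (g^T *m g) l ->
  exists2 v, 0 < bform 1%:M v v & bform (g^T *m g) v v = l * bform 1%:M v v.
Proof.
move=> /eigenvalueP[v vl v0]; exists v; first exact: bform1_gt0.
by rewrite /bform vl mulmx1 -scalemxAl mxE.
Qed.

Lemma gram_eigenvalue_ge0 g l : eigenvalue (g^T *m g) l -> 0 <= l.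
Proof.
move=> /gram_eigenvector[v v0 vl]; rewrite -(pmulr_lge0 _ v0) -vl.
have -> : bform (g^T *m g) v v = bform 1%:M (v *m g^T) (v *m g^T).
  by rewrite /bform mulmx1 trmx_mul trmxK !mulmxA.
by rewrite bform1; apply: sumr_ge0 => j _; exact: sqr_ge0.
Qed.

(** The smallest eigenvalue of the Gram matrix bounds its quadratic form from below
    on every column of [X]. *)
Lemma sigma_min_mul_le g X : sigma_min g * frob_norm X <= frob_norm (g *m X).
Proof.
have [l Sl lmin] := rayleigh_min _ (gram_sym g).
have l0 := gram_eigenvalue_ge0 _ _ Sl.
have sl : sigma_min g <= Num.sqrt l.
  apply: ge_inf; last by exists l.
  by exists 0 => _ [m _ <-]; exact: sqrtr_ge0.
apply: le_trans (ler_wpM2r (frob_norm_ge0 X) sl) _.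
rewrite -ler_sqr ?nnegrE ?mulr_ge0 ?frob_norm_ge0 ?sqrtr_ge0//.
rewrite exprMn sqr_sqrtr// (frob_norm_rows _ _ _ erefl) frob_norm_rows1.
by rewrite mulr_sumr; apply: ler_sum => i _; exact: lmin.
Qed.

(** The largest eigenvalue is obtained from the minimum of the opposite form; it also
    shows that the set of singular values is bounded above, without which its
    supremum would be a default value. *)
Lemma le_sigma_max_mul g X : frob_norm (g *m X) <= sigma_max g * frob_norm X.
Proof.
have [|m' Sm' m'max] := @rayleigh_min _ _ (- (g^T *m g)).
  by rewrite linearN/= gram_sym.
have [m mE] : exists m, m' = - m by exists (- m'); rewrite opprK.
have Sm : eigenvalue (g^T *m g) m.
  have /eigenvalueP[v vm v0] := Sm'; apply/eigenvalueP; exists v => //.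
  by apply: oppr_inj; rewrite -mulmxN vm mE scaleNr.
have mmax x : bform (g^T *m g) x x <= m * bform 1%:M x x.
  by have := m'max x; rewrite mE mulNr {2}/bform mulmxN mulNmx [X in _ <= X]mxE lerN2.
have m0 := gram_eigenvalue_ge0 _ _ Sm.
have sm : Num.sqrt m <= sigma_max g.
  apply: ub_le_sup; last by exists m.
  exists (Num.sqrt m) => _ [l /gram_eigenvector[v v0 vl] <-].
  by apply: ler_wsqrtr; rewrite -(ler_pM2r v0) -vl.
apply: le_trans (ler_wpM2r (frob_norm_ge0 X) sm).
rewrite -ler_sqr ?nnegrE ?mulr_ge0 ?frob_norm_ge0 ?sqrtr_ge0//.
rewrite exprMn (sqr_sqrtr m0) (frob_norm_rows _ _ _ erefl) frob_norm_rows1.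
by rewrite mulr_sumr; apply: ler_sum => i _; exact: mmax.
Qed.

End SingularValues.

(** * Derivatives relative to the half-line *)

Lemma cvg_mxP (R : realType) (n : nat) (T : Type) (F : set_system T)
    {FF : Filter F} (f : T -> 'M[R]_n.+1) (l : 'M[R]_n.+1) :
  f x @[x --> F] --> l <-> forall i j, f x i j @[x --> F] --> l i j.
Proof.
split=> [fl i j|fl].
  exact: (cvg_comp _ _ fl (@coord_continuous _ _ _ i j l)).
apply/cvgrPdist_le => /= e e0; near=> x.
rewrite /Num.Def.normr/= mx_normrE (bigmax_le _ (ltW e0))//= => i _.
rewrite !mxE/=; move: i; near: x; apply: filter_forall => /= i.
exact: ((cvgrPdist_le _ _).1 (fl i.1 i.2)).
Unshelve. all: by end_near. Qed.

Lemma cvg_ext (T : Type) (U : nbhsType) (F : set_system T) {FF : Filter F}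
    (f g : T -> U) (l : U) :
  f =1 g -> f x @[x --> F] --> l -> g x @[x --> F] --> l.
Proof. by move=> /funext ->. Qed.

Section OneSidedDerivative.
Context {R : realType}.

(** By definition [has_derivative_on_0y f df] is [deriv0y f t (df t)] for all
    [t >= 0]; the pointwise form, with values in any normed space, covers both
    the matrix signals and the scalar Lyapunov function. *)
Definition deriv0y {V : normedModType R} (f : R -> V) (t : R) (l : V) : Prop :=
  (s - t)^-1 *: (f s - f t) @[s --> within `[0, +oo[ t^'] --> l.

Lemma near0y (P : R -> Prop) t : (forall s, 0 <= s -> s != t -> P s) ->
  \forall s \near within `[0, +oo[ t^', P s.
Proof.
move=> h; rewrite near_withinE; near=> s => /=; rewrite in_itv/= andbT => s0.
by apply: h => //; near: s; exact: nbhs_dnbhs_neq.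
Unshelve. all: by end_near. Qed.

Lemma deriv0y_eq {V : normedModType R} (f g : R -> V) t l :
  (forall s, 0 <= s -> f s = g s) -> 0 <= t -> deriv0y g t l -> deriv0y f t l.
Proof.
move=> fg t0; apply: cvg_trans; apply: near_eq_cvg.
by apply: near0y => s s0 _; rewrite !fg.
Qed.

Lemma deriv0y_ext {V : normedModType R} (f g : R -> V) t l :
  f =1 g -> deriv0y f t l -> deriv0y g t l.
Proof. by move=> /funext ->. Qed.

Lemma deriv0y_cvg {V : normedModType R} (f : R -> V) t l : deriv0y f t l ->
  f s @[s --> within `[0, +oo[ t^'] --> f t.
Proof.
move=> fl; apply/subr_cvg0; rewrite -[X in _ --> X](scale0r l).
have st : s - t @[s --> within `[0, +oo[ t^'] --> 0.
  apply/subr_cvg0; exact: (cvg_trans (cvg_within _) (@nbhs_dnbhs _ t)).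
apply: cvg_trans (cvgZ st fl).  apply: near_eq_cvg.
by apply: near0y => s _ st'; rewrite scalerA divff ?scale1r// subr_eq0.
Qed.

Lemma deriv0y_cst {V : normedModType R} (c : V) t : deriv0y (fun=> c) t 0.
Proof.
rewrite /deriv0y; under eq_cvg do rewrite subrr scaler0; exact: cvg_cst.
Qed.

Lemma deriv0yD {V : normedModType R} (f g : R -> V) t l m :
  deriv0y f t l -> deriv0y g t m -> deriv0y (fun s => f s + g s) t (l + m).
Proof.
move=> fl gm; apply: cvg_ext (cvgD fl gm) => s.
by rewrite -scalerDr opprD addrACA.
Qed.

Lemma deriv0yB {V : normedModType R} (f g : R -> V) t l m :
  deriv0y f t l -> deriv0y g t m -> deriv0y (fun s => f s - g s) t (l - m).
Proof.
move=> fl gm; apply: cvg_ext (cvgB fl gm) => s.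
by rewrite !fctE -scalerBr !opprD !opprK addrACA.
Qed.

Lemma deriv0yM (f g : R -> R) t l m :
  deriv0y f t l -> deriv0y g t m ->
  deriv0y (fun s => f s * g s) t (l * g t + f t * m).
Proof.
move=> fl gm; have gt := deriv0y_cvg _ _ _ gm.
apply: cvg_ext (cvgD (cvgM fl gt) (cvgM (cvg_cst (f t)) gm)) => s.
by rewrite ?fctE /GRing.scale/=; ring.
Qed.

Lemma deriv0y_sum (I : finType) (f : I -> R -> R) t (l : I -> R) :
  (forall i, deriv0y (f i) t (l i)) ->
  deriv0y (fun s => \sum_i f i s) t (\sum_i l i).
Proof.
move=> fl; apply: cvg_ext (cvg_sum _ _ _ _ _ _ fl) => s.
by rewrite -scaler_sumr sumrB.
Qed.

Lemma deriv0y_mxP (n : nat) (f : R -> 'M[R]_n.+1) t l :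
  deriv0y f t l <-> forall i j, deriv0y (fun s => f s i j) t (l i j).
Proof.
split=> [/cvg_mxP fl i j|fl].
  by apply: cvg_ext (fl i j) => s; rewrite !mxE.
by apply/cvg_mxP => i j; apply: cvg_ext (fl i j) => s; rewrite !mxE.
Qed.

Lemma deriv0y_mulmx (n : nat) (f g : R -> 'M[R]_n.+1) t l m :
  deriv0y f t l -> deriv0y g t m ->
  deriv0y (fun s => f s *m g s) t (l *m g t + f t *m m).
Proof.
move=> /deriv0y_mxP fl /deriv0y_mxP gm; apply/deriv0y_mxP => i j.
rewrite !mxE -big_split/=.
have -> : (fun s => (f s *m g s) i j) = fun s => \sum_k f s i k * g s k j.
  by apply/funext => s; rewrite mxE.
by apply: deriv0y_sum => k; exact: deriv0yM.
Qed.

Lemma deriv0y_frob_inner (n : nat) (f g : R -> 'M[R]_n.+1) t l m :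
  deriv0y f t l -> deriv0y g t m ->
  deriv0y (fun s => frob_inner (f s) (g s)) t
    (frob_inner l (g t) + frob_inner (f t) m).
Proof.
move=> /deriv0y_mxP fl /deriv0y_mxP gm; rewrite !frob_innerE -big_split/=.
under eq_bigr do rewrite -big_split/=.
apply: (@deriv0y_ext _ (fun s => \sum_i \sum_j f s i j * g s i j)) => [s|].
  by rewrite frob_innerE.
by apply: deriv0y_sum => i; apply: deriv0y_sum => j; exact: deriv0yM.
Qed.

Lemma deriv0y_is_derive (f : R -> R) t l : 0 < t ->
  deriv0y f t l -> is_derive t 1 f l.
Proof.
move=> t0 fl.
suff h : h^-1 *: ((f \o shift t) (h *: 1) - f t) @[h --> 0^'] --> l.
  by split; [apply/cvg_ex; exists l|exact/cvg_lim].
move/cvgrPdist_le : fl => fl; apply/cvgrPdist_le => /= e /fl.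
rewrite near_withinE => -[d /= d0 fd]; exists (Num.min d t) => /=.
  by rewrite lt_min d0.
move=> h; rewrite /ball_/= sub0r normrN lt_min => /andP[hd ht] h0.
have := fd (h + t); rewrite /ball_/= opprD addrCA subrr addr0 normrN hd.
rewrite addrK in_itv/= andbT => /(_ isT) hh.
rewrite [h *: 1]mulr1; apply: hh.
  by rewrite -subr_eq0 addrK.
by move: ht; rewrite ltr_norml => /andP[]; lra.
Qed.

Lemma deriv0y_within_continuous (f : R -> R) (df : R -> R) :
  (forall t, 0 <= t -> deriv0y f t (df t)) -> {within `[0, +oo[, continuous f}.
Proof.
move=> fdf; apply/continuous_within_itvcyP; split.
  move=> t; rewrite in_itv/= andbT => t0.
  have [/derivable1_diffP ff _] := deriv0y_is_derive _ _ _ t0 (fdf t (ltW t0)).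
  exact: differentiable_continuous.
have /cvgrPdist_le f0 := deriv0y_cvg _ _ _ (fdf 0 (lexx 0)).
apply/cvgrPdist_le => e /f0; rewrite near_withinE => -[d /= d0 fd].
exists d => //= s sd s0; apply: fd => //=.
  by rewrite gt_eqF.
by rewrite in_itv/= ltW.
Qed.

Lemma is_derive_deriv0y (f : R -> R) (t l : R) : is_derive t 1 f l -> deriv0y f t l.
Proof.
move=> [df fl]; rewrite -fl.
have {df fl} /cvgrPdist_le fl :
    h^-1 *: ((f \o shift t) (h *: 1) - f t) @[h --> 0^']
    --> 'D_1 f t by exact: df.
apply/cvgrPdist_le => /= e /fl -[d /= d0 fd].
rewrite near_withinE; exists d => //= s; rewrite /ball_/= => sd st _.
have := fd (s - t); rewrite /ball_/= sub0r opprB subr_eq0 => /(_ sd st).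
by rewrite [_ *: 1]mulr1 subrK.
Qed.

(** The function [expR (a * s) * W s] has nonpositive derivative, so it does not
    increase. *)
Lemma deriv0y_exp_decay (W dW : R -> R) (a : R) :
  (forall t, 0 <= t -> deriv0y W t (dW t)) ->
  (forall t, 0 <= t -> dW t <= - (a * W t)) ->
  forall t, 0 <= t -> W t <= W 0 * expR (- (a * t)).
Proof.
move=> dWP dWle t t0; pose f (s : R) := expR (a * s) * W s.
have df (s : R) : 0 <= s -> deriv0y f s (expR (a * s) * (a * W s + dW s)).
  move=> s0; have dexp : deriv0y (fun s => expR (a * s)) s (a * expR (a * s)).
    apply: is_derive_deriv0y.
    by apply: is_derive_eq; rewrite /GRing.scale/= mulr1 mulrC.
  have := deriv0yM _ _ _ _ _ dexp (dWP s s0).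
  by congr (deriv0y _ _ _); ring.
have df' (s : R) : s \in `]0, +oo[%R ->
    is_derive s 1 f (expR (a * s) * (a * W s + dW s)).
  rewrite in_itv/= andbT => s0; apply: deriv0y_is_derive => //.
  by apply: df; exact: ltW.
have f0 : f t <= f 0.
  apply: (ler0_derive1_nincry _ _ (deriv0y_within_continuous _ _ df)) => // s s0.
    by have [] := df' s s0.
  have [_] := df' s s0; rewrite derive1E => ->.
  rewrite pmulr_rle0 ?expR_gt0// -lerBrDl sub0r; apply: dWle.
  by move: s0; rewrite in_itv/= andbT => /ltW.
move: f0; rewrite /f mulr0 expR0 mul1r => f0.
rewrite expRN -(ler_pM2l (expR_gt0 (a * t))) mulrCA divff ?mulr1//.
by rewrite gt_eqF// expR_gt0.
Qed.

End OneSidedDerivative.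

(** * The Lie algebra as a linear space, and the inverse of a curve *)

Section LieAlgebra.
Context {R : realType} {n : nat}.
Local Notation M := 'M[R]_n.+1.

Lemma is_derive_mxP (f : R -> M) (t v : R) (l : M) :
  is_derive t v f l <-> forall i j, is_derive t v (fun s => f s i j) (l i j).
Proof.
split=> [[df fl] i j|fl].
  by split; [exact: (derivable_mxP _ _ _).1 df i j|rewrite -fl derive_mx// mxE].
have df : derivable f t v by apply/derivable_mxP => i j; have [] := fl i j.
split=> //; rewrite derive_mx//; apply/matrixP => i j; rewrite mxE.
by have [] := fl i j.
Qed.

Lemma is_derive_mulmx (f g : R -> M) (t v : R) (l m : M) :
  is_derive t v f l -> is_derive t v g m ->
  is_derive t v (fun s => f s *m g s) (l *m g t + f t *m m).
Proof.
move=> /is_derive_mxP fl /is_derive_mxP gm; apply/is_derive_mxP => i j.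
have -> : (fun s => (f s *m g s) i j) =
    \sum_k ((fun s => f s i k) * (fun s => g s k j)).
  by apply/funext => s; rewrite mxE fct_sumE.
rewrite !mxE -big_split/=; apply: is_derive_sum => k.
apply: is_derive_eq (is_deriveM (fl i k) (gm k j)) _.
by rewrite addrC; congr (_ + _); exact: mulrC.
Qed.

Lemma is_derive_mx_rescale (f : R -> M) (t k : R) (l : M) :
  is_derive (k * t) 1 f l -> is_derive t 1 (fun s => f (k * s)) (k *: l).
Proof.
move=> /is_derive_mxP fl; apply/is_derive_mxP => i j; rewrite mxE.
have dk : is_derive t 1 (fun s : R => k * s) k.
  by apply: is_derive_eq; rewrite /GRing.scale/= mulr1.
by rewrite mulrC; exact: is_derive1_comp (fl i j) dk.
Qed.

Lemma derivable_is_derive (f : R -> M) (t : R) :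
  derivable f t 1 -> is_derive t 1 f ('D_1 f t).
Proof. by move=> df; split. Qed.

(** Sums are the velocities of products of curves, multiples those of reparametrised
    curves. *)
Lemma Lie_algebra_linear (G : set M) :
  matrix_Lie_group G -> linear_set (Lie_algebra G).
Proof.
move=> [_ G1 GM _ _]; split.
- exists (fun=> 1%:M); split=> //.
  by near=> t; split=> //; exact: derivable_cst.
  exact: is_derive_cst.
- move=> X Y [c [c0 cG cX]] [d [d0 dG dY]]; exists (fun s => c s *m d s); split.
  + by rewrite c0 d0 mulmx1.
  + apply: filterS2 cG dG => t [Gc dc] [Gd dd]; split; first exact: GM.
    by have [] := is_derive_mulmx _ _ _ _ _ _ (derivable_is_derive _ _ dc)
      (derivable_is_derive _ _ dd).
  + have := is_derive_mulmx _ _ _ _ _ _ cX dY.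
    by rewrite c0 d0 mulmx1 mul1mx.
- move=> k X [c [c0 cG cX]]; exists (fun s => c (k * s)); split.
  + by rewrite mulr0.
  + have near_rescale (P : set R) :
        (\forall s \near (0 : R), P s) -> \forall s \near (0 : R), P (k * s).
      have : k * s @[s --> (0 : R)] --> k * 0 by exact: mulrl_continuous.
      by rewrite mulr0 => k0; exact: k0.
    have ck := near_rescale [set s | G (c s) /\ derivable c s 1] cG.
    apply: filterS ck => t [Gc dc]; split; first exact: Gc.
    by have [] := is_derive_mx_rescale _ _ _ _ (derivable_is_derive _ _ dc).
  + by apply: is_derive_mx_rescale; rewrite mulr0.
Unshelve. all: by end_near. Qed.
End LieAlgebra.

Section Inverse.
Context {R : realType} {n : nat}.
Local Notation M := 'M[R]_n.+1.

Lemma cvg_mulmx (T : Type) (F : set_system T) {FF : Filter F} (f g : T -> M) (l m : M) :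
  f x @[x --> F] --> l -> g x @[x --> F] --> m ->
  f x *m g x @[x --> F] --> l *m m.
Proof.
move=> /cvg_mxP fl /cvg_mxP gm; apply/cvg_mxP => i j; rewrite mxE.
apply: (@cvg_ext _ _ F _ (fun x => \sum_k f x i k * g x k j)) => [x|].
  by rewrite mxE.
by apply: cvg_sum => k; exact: cvgM.
Qed.

Lemma cvg_frob_norm0 (T : Type) (F : set_system T) {FF : Filter F} (f : T -> M) :
  f x @[x --> F] --> (0 : M) -> frob_norm (f x) @[x --> F] --> (0 : R).
Proof.
move=> /cvg_mxP f0; rewrite -[X in _ --> X](@sqrtr0 R).
apply: (cvg_comp (fun x => frob_inner (f x) (f x)) Num.sqrt); last exact: sqrt_continuous.
apply: (@cvg_ext _ _ F _ (fun x => \sum_i \sum_j f x i j * f x i j)) => [x|].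
  by rewrite frob_innerE.
have /esym e0 : frob_inner (0 : M) 0 = 0 by rewrite /frob_inner mulmx0 mxtrace0.
rewrite [X in _ --> X]e0 frob_innerE.
apply: cvg_sum => i; apply: cvg_sum => j.
by apply: cvgM; exact: f0.
Qed.

(** Everything follows from
    [g(s)^-1 - g(t)^-1 = - g(s)^-1 (g(s) - g(t)) g(t)^-1]: the uniform bound on
    the inverses first gives their continuity, and then the difference quotient
    converges. *)
Lemma deriv0y_invmx (g : R -> M) (K t : R) (l : M) : 0 <= t ->
  (forall s, 0 <= s -> g s \in unitmx) ->
  (forall s, 0 <= s -> frob_norm (invmx (g s)) <= K) ->
  deriv0y g t l ->
  deriv0y (fun s => invmx (g s)) t (- (invmx (g t) *m l *m invmx (g t))).
Proof.
move=> t0 gU gK gl.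
have dinv s : 0 <= s -> invmx (g s) - invmx (g t) =
    - (invmx (g s) *m (g s - g t) *m invmx (g t)).
  move=> s0; rewrite mulmxBr mulVmx ?gU// mulmxBl mul1mx -mulmxA mulmxV ?gU//.
  by rewrite mulmx1 opprB.
have K0 : 0 <= K by exact: le_trans (frob_norm_ge0 _) (gK t t0).
have diff0 : frob_norm (g s - g t) @[s --> within `[0, +oo[ t^'] --> (0 : R).
  by apply: cvg_frob_norm0; apply/subr_cvg0; exact: deriv0y_cvg gl.
have cinv : invmx (g s) @[s --> within `[0, +oo[ t^'] --> invmx (g t).
  apply/cvg_mxP => i j; apply/subr_cvg0.
  suff : `|invmx (g s) i j - invmx (g t) i j|
      @[s --> within `[0, +oo[ t^'] --> (0 : R).
    exact: norm_cvg0.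
  apply: (@squeeze_cvgr _ (within `[0, +oo[ t^') _ _ (fun=> 0)
    (fun s => K * K * frob_norm (g s - g t))).
  - apply: near0y => s s0 _; rewrite normr_ge0/=.
    have -> : invmx (g s) i j - invmx (g t) i j = (invmx (g s) - invmx (g t)) i j.
      by rewrite !mxE.
    apply: le_trans (ler_entry_frob_norm _ i j) _.
    rewrite dinv// -mulNmx -mulmxN opprB mulrAC.
    apply: le_trans (frob_normM _ _) (ler_pM _ _ _ (gK t t0)); rewrite ?frob_norm_ge0//.
    apply: le_trans (frob_normM _ _) _.
    by apply: ler_pM; rewrite ?frob_norm_ge0 ?gK// -opprB frob_normN.
  - exact: cvg_cst.
  - by rewrite -[X in _ --> X](mulr0 (K * K)); apply: cvgM diff0; exact: cvg_cst.
have : - (invmx (g s) *m ((s - t)^-1 *: (g s - g t)) *m invmx (g t))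
    @[s --> within `[0, +oo[ t^'] --> - (invmx (g t) *m l *m invmx (g t)).
  apply: cvgN; apply: cvg_mulmx; last exact: cvg_cst.
  exact: cvg_mulmx cinv gl.
apply: cvg_trans; apply: near_eq_cvg; apply: near0y => s s0 _ /=.
by rewrite dinv// scalerN -scalemxAr -scalemxAl.
Qed.
End Inverse.

(** * The strict Lyapunov function *)

(** Here [e] and [h] stand for the norms of the two errors. The cross product
    [c1 e h] is split by Young's inequality into half of [q h^2] and a multiple of
    [e^2], so that the coefficient of [2 eps e^2] becomes at most [D]. The first
    term of the minimum defining [eps] lets [eps D] use at most half of [kI k],
    the second bounds the cross term [2 eps m e h] by half of [kI e^2 + h^2]. The
    factor [3] in the rate leaves room for the comparison of [W] with
    [3/2 (kI e^2 + h^2)], which turns the bound into [- 2 a W]. *)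
Lemma lyapunov_constants (R : realFieldType) (k kI c1 c2 m q : R) :
  0 < k -> 0 < kI -> 0 <= c2 -> 0 <= m -> 0 < q ->
  exists eps a : R, [/\ 0 < eps, 0 < a &
    forall e h : R, 0 <= e -> 0 <= h ->
      2 * eps * (m * e * h) <= (kI * e ^+ 2 + h ^+ 2) / 2 /\
      - (2 * kI * k * e ^+ 2)
        + 2 * eps * (c1 * e * h + c2 * e ^+ 2 - q * h ^+ 2) <=
      - (3 * a * (kI * e ^+ 2 + h ^+ 2))].
Proof.
move=> k0 kI0 c20 m0 q0.
pose D := c2 + c1 ^+ 2 / (2 * q) + 1.
have D0 : 0 < D.
  by rewrite ltr_wpDl// addr_ge0// divr_ge0 ?sqr_ge0// mulr_ge0// ltW.
pose eps := Num.min (kI * k / (2 * D)) (Num.min kI 1 / (2 * (m + 1))).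
have m1 : 0 < m + 1 by rewrite ltr_wpDl.
have min0 : 0 < Num.min kI 1 by rewrite lt_min kI0 ltr01.
have eps0 : 0 < eps.
  by rewrite lt_min !divr_gt0// ?mulr_gt0.
have epsD : eps * D <= kI * k / 2.
  have : eps <= kI * k / (2 * D) by rewrite ge_min lexx.
  by rewrite invfM mulrA ler_pdivlMr.
have epsm : eps * m <= Num.min kI 1 / 2.
  have : eps <= Num.min kI 1 / (2 * (m + 1)) by rewrite ge_min lexx orbT.
  rewrite invfM mulrA ler_pdivlMr// => h.
  by apply: le_trans h; rewrite ler_pM2l// lerDl.
have [epsmkI epsm1] : eps * m <= kI / 2 /\ eps * m <= 1 / 2.
  by split; apply: le_trans epsm _; rewrite ler_pM2r ?invr_gt0// ge_min lexx ?orbT.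
pose a := Num.min k (eps * q) / 3.
have a0 : 0 < a by rewrite divr_gt0// lt_min k0 mulr_gt0.
have ak : 3 * a <= k by rewrite /a mulrCA divff// mulr1 ge_min lexx.
have aq : 3 * a <= eps * q by rewrite /a mulrCA divff// mulr1 ge_min lexx orbT.
clearbody eps a; exists eps, a; split=> // e h e0 h0.
have e2 : 0 <= e ^+ 2 := sqr_ge0 e.
have h2 : 0 <= h ^+ 2 := sqr_ge0 h.
have em0 : 0 <= eps * m by rewrite mulr_ge0// ltW.
have eh : 2 * (e * h) <= e ^+ 2 + h ^+ 2.
  by have := sqr_ge0 (e - h); rewrite sqrrB -mulr_natl; lra.
split.
  have := ler_wpM2l em0 eh.
  have := ler_wpM2r e2 epsmkI; have := ler_wpM2r h2 epsm1.
  by rewrite !mulrDr; lra.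
have young : c1 * e * h <= q * h ^+ 2 / 2 + c1 ^+ 2 / (2 * q) * e ^+ 2.
  have := sqr_ge0 (q * h - c1 * e).
  rewrite -(pmulr_rge0 (x := (2 * q)^-1)) ?invr_gt0 ?mulr_gt0//.
  have -> : (2 * q)^-1 * (q * h - c1 * e) ^+ 2 =
    q * h ^+ 2 / 2 + c1 ^+ 2 / (2 * q) * e ^+ 2 - c1 * e * h by field; lra.
  by rewrite subr_ge0.
have main : c1 * e * h + c2 * e ^+ 2 - q * h ^+ 2 <= D * e ^+ 2 - q * h ^+ 2 / 2.
  by move: young; rewrite /D; set X := c1 ^+ 2 / (2 * q); lra.
have := ler_wpM2l (ltW eps0) main.
have := ler_wpM2r e2 epsD.
have := ler_wpM2r (mulr_ge0 (ltW kI0) e2) ak.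
have := ler_wpM2r h2 aq.
rewrite !mulrBr; lra.
Qed.

Section Lyapunov.
Context {R : realType} {n : nat}.
Local Notation M := 'M[R]_n.+1.
Implicit Types E e A X x P : M.

Definition lyapunov (kI eps : R) E e A : R :=
  kI * frob_inner E E + frob_inner e e - 2 * eps * frob_inner E (e *m A).

(** The last hypothesis says that the cross term is at most half of the main part. *)
Lemma lyapunov_sandwich kI eps m E e A :
  frob_norm A <= m -> 0 <= eps ->
  2 * eps * (m * frob_norm E * frob_norm e) <=
    (kI * frob_norm E ^+ 2 + frob_norm e ^+ 2) / 2 ->
  `|lyapunov kI eps E e A - (kI * frob_norm E ^+ 2 + frob_norm e ^+ 2)| <=
    (kI * frob_norm E ^+ 2 + frob_norm e ^+ 2) / 2.
Proof.
move=> Am eps0; apply: le_trans.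
rewrite !sqr_frob_norm /lyapunov addrAC subrr sub0r normrN normrM.
rewrite ger0_norm ?mulr_ge0//; apply: ler_wpM2l; first by rewrite mulr_ge0.
apply: le_trans (frob_cauchy_schwarz _ _) _.
rewrite [m * _]mulrC -mulrA ler_wpM2l ?frob_norm_ge0// mulrC.
apply: le_trans (frob_normM _ _) _.
by rewrite ler_wpM2l ?frob_norm_ge0.
Qed.

(** The derivative of [lyapunov] at a point moving with velocity [(dE, de, dA)]. *)
Definition lyapunov_rate (kI eps : R) E e A (dE de dA : M) : R :=
  kI * (frob_inner dE E + frob_inner E dE) + (frob_inner de e + frob_inner e de)
  - 2 * eps * (frob_inner dE (e *m A) + frob_inner E (de *m A + e *m dA)).

(** The matrix [X] is [xi + b] and [x] is [xi], while the two equations about [P] are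
    what remains of the projection: it tests like [E *m A^T] against [e] and
    against itself. The first makes the terms [<E, e A>] coming from [E] and from
    [e] cancel, the second gives [|P| <= |E A^T|]. The decay of [e] is the term
    [|e A|^2]; every other contribution of the cross term is estimated by
    Cauchy-Schwarz. *)
Lemma lyapunov_rate_le (kP kI eps beta Bx m q : R) E e A X x P :
  0 < kI -> 0 <= eps -> 0 <= kP ->
  frob_norm X <= beta -> frob_norm x <= Bx -> frob_norm A <= m ->
  q * frob_norm e ^+ 2 <= frob_norm (e *m A) ^+ 2 ->
  frob_inner P e = frob_inner (E *m A^T) e ->
  frob_inner P P = frob_inner (E *m A^T) P ->
  lyapunov_rate kI eps E e A (e *m A - X *m E - kP *: E) (- (kI *: P))
    (- (x *m A)) <=
  - (2 * kI * (kP - beta) * frob_norm E ^+ 2)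
  + 2 * eps * ((beta + kP + Bx) * m * frob_norm E * frob_norm e
               + kI * m ^+ 2 * frob_norm E ^+ 2 - q * frob_norm e ^+ 2).
Proof.
move=> kI0 eps0 kP0 Xb xB Am qe Pe PP.
pose eA := e *m A.
have E0 := frob_norm_ge0 E; have e0 := frob_norm_ge0 e.
have m0 : 0 <= m := le_trans (frob_norm_ge0 A) Am.
have b0 : 0 <= beta := le_trans (frob_norm_ge0 X) Xb.
have Bx0 : 0 <= Bx := le_trans (frob_norm_ge0 x) xB.
have eAm : frob_norm eA <= frob_norm e * m.
  by apply: le_trans (frob_normM _ _) _; rewrite ler_wpM2l.
have XE : frob_norm (X *m E) <= beta * frob_norm E.
  by apply: le_trans (frob_normM _ _) _; rewrite ler_wpM2r.
have cs (Y Z : M) (y z : R) : frob_norm Y <= y -> frob_norm Z <= z ->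
    `|frob_inner Y Z| <= y * z.
  move=> Yy Zz; apply: le_trans (frob_cauchy_schwarz Y Z) _.
  by apply: ler_pM; rewrite ?frob_norm_ge0.
have b1 := cs _ _ _ _ (lexx (frob_norm E)) XE.
have b2 := cs _ _ _ _ XE eAm.
have b3 := cs _ _ _ _ (lexx (frob_norm E)) eAm.
have b4 : `|frob_inner E (e *m (x *m A))| <= frob_norm E * (frob_norm e * (Bx * m)).
  apply: cs => //; apply: le_trans (frob_normM _ _) _.
  rewrite ler_wpM2l//; apply: le_trans (frob_normM _ _) _.
  by apply: ler_pM; rewrite ?frob_norm_ge0.
have b5 : frob_inner P P <= frob_norm E ^+ 2 * m ^+ 2.
  have EAm : frob_norm (E *m A^T) <= frob_norm E * m.
    apply: le_trans (frob_normM _ _) _; rewrite frob_norm_tr.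
    by rewrite ler_wpM2l.
  have PE : frob_norm P <= frob_norm E * m.
    apply: le_trans EAm; have [->|P0] := eqVneq (frob_norm P) 0.
      exact: frob_norm_ge0.
    have Pgt0 : 0 < frob_norm P by rewrite lt_def P0 frob_norm_ge0.
    rewrite -(ler_pM2r Pgt0) -expr2 sqr_frob_norm PP.
    exact: le_trans (ler_norm _) (frob_cauchy_schwarz _ _).
  rewrite -sqr_frob_norm -exprMn ler_sqr ?nnegrE ?mulr_ge0 ?frob_norm_ge0//.
have -> : lyapunov_rate kI eps E e A (eA - X *m E - kP *: E) (- (kI *: P))
    (- (x *m A)) =
  - (2 * kI * frob_inner E (X *m E)) - 2 * kI * kP * frob_inner E E
  - 2 * eps * (frob_inner eA eA - frob_inner (X *m E) eA - kP * frob_inner E eA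
     - kI * frob_inner P P - frob_inner E (e *m (x *m A))).
  rewrite /lyapunov_rate (frob_innerC (eA - _ - _)) (frob_innerC _ e).
  rewrite !(frob_innerDr, frob_innerDl, frob_innerNr, frob_innerNl,
    frob_innerZr, frob_innerZl, mulmxN, mulNmx) -!scalemxAl !frob_innerZr.
  rewrite (frob_inner_mulr E P A) -PP (frob_innerC e P) Pe -(frob_inner_mulr E e A).
  by rewrite -/eA; ring.
move: qe b1 b2 b3 b4 b5; rewrite -/eA !sqr_frob_norm -[frob_inner E E]sqr_frob_norm.
move: (frob_inner e e) (frob_inner eA eA) (frob_inner E (X *m E))
  (frob_inner (X *m E) eA) (frob_inner E eA) (frob_inner E (e *m (x *m A)))
  (frob_inner P P) (frob_norm E) (frob_norm e) => ee s1 s2 s3 s4 s5 s6 y h.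
move=> h1 /ler_normlP[h2 _] /ler_normlP[_ h3] /ler_normlP[_ h4] /ler_normlP[_ h5] h6.
have h4' := ler_wpM2l kP0 h4.
have h6' := ler_wpM2l (ltW kI0) h6.
have sum : s3 + kP * s4 + kI * s6 + s5 - s1 <=
    (beta + kP + Bx) * m * y * h + kI * m ^+ 2 * y ^+ 2 - q * ee.
  lra.
have := ler_wpM2l (ltW kI0) h2; have := ler_wpM2l eps0 sum; lra.
Qed.
End Lyapunov.

(** * Exponential convergence *)

Lemma frob_norm_unit_bounds (R : realType) (n : nat) (g : 'M[R]_n.+1) (L U : R) :
  g \in unitmx -> 0 < L -> L <= sigma_min g -> sigma_max g <= U ->
  frob_norm g <= U * frob_norm (1%:M : 'M[R]_n.+1) /\
  frob_norm (invmx g) <= L^-1 * frob_norm (1%:M : 'M[R]_n.+1).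
Proof.
move=> gU L0 Lg gU'; split.
  rewrite -{1}[g]mulmx1; apply: le_trans (le_sigma_max_mul _ _) _.
  by rewrite ler_wpM2r ?frob_norm_ge0.
rewrite mulrC ler_pdivlMr// mulrC -(mulmxV gU).
apply: le_trans (sigma_min_mul_le _ _).
by rewrite ler_wpM2r ?frob_norm_ge0.
Qed.

(** Passing from the decay of the Lyapunov function, compared on both sides with
    [kI e^2 + h^2], to the decay of [e + h]. The constant under the root combines
    the factor [3] between the two comparisons, the factor [2] in
    [(e + h)^2 <= 2 (e^2 + h^2)], and the ratio of the extreme weights. *)
Lemma sum_norms_decay (R : realType) (kI a V0 Vt e0 h0 e h t : R) :
  0 < kI -> 0 <= e0 -> 0 <= h0 -> 0 <= e -> 0 <= h ->
  V0 <= 3 / 2 * (kI * e0 ^+ 2 + h0 ^+ 2) ->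
  (kI * e ^+ 2 + h ^+ 2) / 2 <= Vt ->
  Vt <= V0 * expR (- (2 * a * t)) ->
  e + h <= Num.sqrt (6 * Num.max kI 1 / Num.min kI 1) * (e0 + h0) * expR (- (a * t)).
Proof.
move=> kI0 e00 h00 e0' h0' V0le Vtge dec.
have mn0 : 0 < Num.min kI 1 by rewrite lt_min kI0 ltr01.
have mx0 : 0 < Num.max kI 1 by rewrite lt_max kI0.
set mn := Num.min kI 1 in mn0 *; set mx := Num.max kI 1 in mx0 *.
have [mnkI mn1] : mn <= kI /\ mn <= 1 by rewrite /mn !ge_min !lexx orbT.
have [mxkI mx1] : kI <= mx /\ 1 <= mx by rewrite /mx !le_max !lexx orbT.
clearbody mn mx.
set x := expR (- (a * t)); have x0 : 0 < x := expR_gt0 _.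
have xx : expR (- (2 * a * t)) = x ^+ 2.
  by rewrite /x -expRM_natl; congr expR; ring.
rewrite -ler_sqr ?nnegrE ?addr_ge0 ?mulr_ge0 ?addr_ge0 ?sqrtr_ge0//; last exact: ltW.
rewrite !exprMn sqr_sqrtr; last by rewrite divr_ge0 ?mulr_ge0// ltW.
have -> : 6 * mx / mn * (e0 + h0) ^+ 2 * x ^+ 2 =
    (6 * (mx * (e0 + h0) ^+ 2) * x ^+ 2) / mn.
  by field; lra.
rewrite ler_pdivlMr//.
have l1 : (e + h) ^+ 2 * mn <= 2 * (kI * e ^+ 2 + h ^+ 2).
  have := ler_wpM2r (sqr_ge0 e) mnkI; have := ler_wpM2r (sqr_ge0 h) mn1.
  have := mulr_ge0 (ltW mn0) (sqr_ge0 (e - h)).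
  by rewrite !expr2; lra.
have l2 : kI * e0 ^+ 2 + h0 ^+ 2 <= mx * (e0 + h0) ^+ 2.
  have := ler_wpM2r (sqr_ge0 e0) mxkI; have := ler_wpM2r (sqr_ge0 h0) mx1.
  have := mulr_ge0 (ltW mx0) (mulr_ge0 e00 h00).
  by rewrite !expr2; lra.
move: dec; rewrite xx => dec.
have x2 : 0 <= x ^+ 2 := sqr_ge0 x.
have l3 : V0 * x ^+ 2 <= 3 / 2 * (mx * (e0 + h0) ^+ 2) * x ^+ 2.
  by apply: ler_wpM2r => //; lra.
lra.
Qed.

Theorem mainTheorem3 (R : realType) (n : nat)
    (G : set 'M[R]_n.+1) (hG : matrix_Lie_group G)
    (g xi : R -> 'M[R]_n.+1)
    (hgG : forall t : R, 0 <= t -> G (g t))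
    (hxi : forall t : R, 0 <= t -> Lie_algebra G (xi t))
    (hg : has_derivative_on_0y g (fun t => g t *m xi t))
    (F : 'M[R]_n.+1) (hF : F \in unitmx)
    (A : R -> 'M[R]_n.+1)
    (hA : forall t : R, 0 <= t -> A t = invmx (g t) *m F)
    (b : 'M[R]_n.+1) (hb : Lie_algebra G b)
    (xim : R -> 'M[R]_n.+1)
    (hxim : forall t : R, 0 <= t -> xim t = xi t + b)
    (Bxi Bb : R) (hBxi0 : 0 < Bxi) (hBb0 : 0 < Bb)
    (hBxi : forall t : R, 0 <= t -> frob_norm (xi t) <= Bxi)
    (hBb : frob_norm b <= Bb)
    (Lg Ug : R) (hLg0 : 0 < Lg) (hUg0 : 0 < Ug)
    (hsigma : forall t : R, 0 <= t ->
       Lg <= sigma_min (g t) /\ sigma_min (g t) <= sigma_max (g t) /\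
       sigma_max (g t) <= Ug)
    (kP kI : R) (hkP : Bxi + Bb < kP) (hkI : 0 < kI) :
  exists a C : R, 0 < a /\ 0 < C /\
    forall Abar bbar : R -> 'M[R]_n.+1,
      observer_solution (Lie_algebra G) kP kI A xim Abar bbar ->
      let EA := fun t : R => A t - Abar t in
      let eb := fun t : R => b - bbar t in
      forall t : R, 0 <= t ->
        frob_norm (EA t) + frob_norm (eb t) <=
          C * (frob_norm (EA 0) + frob_norm (eb 0)) * expR (- (a * t)).
Proof.
pose I := frob_norm (1%:M : 'M[R]_n.+1).
have I0 : 0 <= I := frob_norm_ge0 _.
have gU t : 0 <= t -> g t \in unitmx.
  by move=> /hgG; have [GGL _ _ _ _] := hG => /GGL; rewrite unitmxE unitfE.
have gb t : 0 <= t -> frob_norm (g t) <= Ug * I /\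
    frob_norm (invmx (g t)) <= Lg^-1 * I.
  move=> t0; have [Lgt [_ gtU]] := hsigma t t0.
  exact: frob_norm_unit_bounds (gU t t0) hLg0 Lgt gtU.
pose m := Lg^-1 * I * frob_norm F.
have m0 : 0 <= m by rewrite !mulr_ge0 ?frob_norm_ge0// invr_ge0 ltW.
have Am t : 0 <= t -> frob_norm (A t) <= m.
  move=> t0; rewrite hA//; apply: le_trans (frob_normM _ _) _.
  by rewrite ler_wpM2r ?frob_norm_ge0//; exact: (gb t t0).2.
(* [K] bounds the norm of [A^-1 = F^-1 g]; adding 1 makes it positive. *)
pose K := frob_norm (invmx F) * (Ug * I) + 1.
have K0 : 0 < K.
  by rewrite ltr_wpDl// !mulr_ge0 ?frob_norm_ge0// ltW.
have AK t e : 0 <= t -> K ^- 2 * frob_norm e ^+ 2 <= frob_norm (e *m A t) ^+ 2.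
  move=> t0; have gtU := gU t t0.
  have eE : e = e *m A t *m (invmx F *m g t).
    by rewrite hA// !mulmxA mulmxK// mulmxKV.
  rewrite mulrC ler_pdivrMr ?exprn_gt0// -exprMn.
  rewrite ler_sqr ?nnegrE ?mulr_ge0 ?frob_norm_ge0 ?(ltW K0)//.
  rewrite {1}eE. apply: le_trans (frob_normM _ _) _.
  rewrite ler_wpM2l ?frob_norm_ge0//; apply: le_trans (frob_normM _ _) _.
  rewrite /K ler_wpDr// ler_wpM2l ?frob_norm_ge0//; exact: (gb t t0).1.
have dA t : 0 <= t -> deriv0y A t (- (xi t *m A t)).
  move=> t0; apply: (deriv0y_eq _ _ _ _ hA t0).
  have dinv := deriv0y_invmx _ _ _ _ t0 gU (fun s s0 => (gb s s0).2) (hg t t0).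
  have := deriv0y_mulmx _ _ _ _ _ _ dinv (deriv0y_cst F t).
  rewrite mulmx0 addr0 mulNmx !mulmxA mulVmx ?gU// mul1mx -!mulmxA.
  by rewrite -hA.
have linV := Lie_algebra_linear G hG.
pose beta := Bxi + Bb.
have k0 : 0 < kP - beta by rewrite subr_gt0.
have kP0 : 0 <= kP.
  by apply/ltW/(lt_trans _ hkP); rewrite addr_gt0.
have q0 : 0 < K ^- 2 by rewrite invr_gt0 exprn_gt0.
have c20 : 0 <= kI * m ^+ 2 by rewrite mulr_ge0 ?sqr_ge0// ltW.
have [eps [a [eps0 a0 const]]] := lyapunov_constants _ _ _
  ((beta + kP + Bxi) * m) _ _ _ k0 hkI c20 m0 q0.
exists a, (Num.sqrt (6 * Num.max kI 1 / Num.min kI 1)); split=> //; split.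
  by rewrite sqrtr_gt0 divr_gt0 ?mulr_gt0// ?lt_max ?lt_min ?hkI ?ltr01.
move=> Abar bbar [bV dAbar dbbar] EA eb t t0.
pose V (s : R) := kI * frob_norm (EA s) ^+ 2 + frob_norm (eb s) ^+ 2.
pose W (s : R) := lyapunov kI eps (EA s) (eb s) (A s).
pose P s := orth_proj (Lie_algebra G) (EA s *m (A s)^T).
have [V0 VD VZ] := linV.
have ebV s : 0 <= s -> Lie_algebra G (eb s).
  by move=> s0; rewrite /eb -scaleN1r; apply: VD => //; exact/VZ/bV.
have sandwich s : 0 <= s -> V s / 2 <= W s <= 3 / 2 * V s.
  move=> s0.
  have [c1 _] := const _ _ (frob_norm_ge0 (EA s)) (frob_norm_ge0 (eb s)).
  have := lyapunov_sandwich _ _ _ _ _ _ (Am s s0) (ltW eps0) c1.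
  by rewrite -/(W s) -/(V s) ler_norml => /andP[]; lra.
pose dE s := eb s *m A s - (xi s + b) *m EA s - kP *: EA s.
have dEA s : 0 <= s -> deriv0y EA s (dE s).
  move=> s0; have := deriv0yB _ _ _ _ _ (dA s s0) (dAbar s s0).
  congr (deriv0y _ _ _); rewrite /dE /eb /EA hxim//.
  rewrite !mulmxBl !mulmxBr !mulmxDl.
  move: (xi s *m A s) (b *m A s) (xi s *m Abar s) (b *m Abar s) (bbar s *m A s)
    (A s - Abar s) => p1 p2 p3 p4 p5 p6.
  by apply/matrixP => i j; rewrite !mxE; ring.
have deb s : 0 <= s -> deriv0y eb s (- (kI *: P s)).
  move=> s0; have := deriv0yB _ _ _ _ _ (deriv0y_cst b s) (dbbar s s0).
  by rewrite sub0r.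
pose dW s := lyapunov_rate kI eps (EA s) (eb s) (A s) (dE s) (- (kI *: P s))
  (- (xi s *m A s)).
have dWP s : 0 <= s -> deriv0y W s (dW s).
  move=> s0; have dE' := dEA s s0; have de' := deb s s0.
  have dEE := deriv0y_frob_inner _ _ _ _ _ _ dE' dE'.
  have dee := deriv0y_frob_inner _ _ _ _ _ _ de' de'.
  have dEeA := deriv0y_frob_inner _ _ _ _ _ _ dE'
    (deriv0y_mulmx _ _ _ _ _ _ de' (dA s s0)).
  have := deriv0yB _ _ _ _ _
    (deriv0yD _ _ _ _ _ (deriv0yM _ _ _ _ _ (deriv0y_cst kI s) dEE) dee)
    (deriv0yM _ _ _ _ _ (deriv0y_cst (2 * eps) s) dEeA).
  by rewrite !mul0r !add0r.
have dWle s : 0 <= s -> dW s <= - (2 * a * W s).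
  move=> s0.
  have [PV Porth] := orth_projP _ (EA s *m (A s)^T) linV.
  have Xb : frob_norm (xi s + b) <= beta.
    by apply: le_trans (frob_normD _ _) _; rewrite lerD// hBxi.
  have := lyapunov_rate_le kP kI eps beta Bxi m (K ^- 2)
    (EA s) (eb s) (A s) _ _ (P s)
    hkI (ltW eps0) kP0 Xb (hBxi s s0) (Am s s0) (AK s (eb s) s0)
    (Porth _ (ebV s s0)) (Porth _ PV).
  have [_ c2] := const _ _ (frob_norm_ge0 (EA s)) (frob_norm_ge0 (eb s)).
  move=> /le_trans/(_ c2); rewrite -/(V s) -/(dE s) -/(dW s) => dWV.
  have /andP[_ WV] := sandwich s s0.
  by apply: le_trans dWV _; have := ler_wpM2l (ltW a0) WV; lra.
have dec := deriv0y_exp_decay _ _ _ dWP dWle t t0.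
have /andP[_ W0] := sandwich 0 (lexx 0); have /andP[Wt _] := sandwich t t0.
exact: sum_norms_decay hkI (frob_norm_ge0 _) (frob_norm_ge0 _)
  (frob_norm_ge0 _) (frob_norm_ge0 _) W0 Wt dec.
Qed.
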